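(* Let $E$ be a normed vector space over $\mathbb K$ ($\mathbb R$ or $\mathbb C$), $(\mathbf S_n)$ a sequence in $E$, $\mathbf y\in E'$ a continuous linear functional on $E$, and $k\ge 0$ a fixed integer. Let $\boldsymbol{\widehat\varepsilon}_{2k}^{(n)}$ be the first topological Shanks transforms of $(\mathbf S_n)$ with respect to $\mathbf y$, let $\varepsilon_{k}^{(n)}$ be the scalars given by the scalar $\varepsilon$-algorithm applied to $(\langle\mathbf y,\mathbf S_n\rangle)$, and set $$r_k^{(n)}=\frac{\varepsilon_{2k+2}^{(n)}-\varepsilon_{2k}^{(n+1)}}{\varepsilon_{2k}^{(n+1)}-\varepsilon_{2k}^{(n)}}.$$ If $\lim_{n\to\infty}\boldsymbol{\widehat\varepsilon}_{2k}^{(n)}=\mathbf S$, and if there exist $M$ and $N$ such that $|r_k^{(n)}|\le M$ for all $n\ge N$, then $\lim_{n\to\infty}\boldsymbol{\widehat\varepsilon}_{2k+2}^{(n)}=\mathbf S$.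
   Context: First topological Shanks transforms: with $\Delta\mathbf S_n=\mathbf S_{n+1}-\mathbf S_n$, for $k,n\ge 0$ let $a_0^{(n,k)},\ldots,a_k^{(n,k)}\in\mathbb K$ be the solution of $\sum_{i=0}^k a_i^{(n,k)}=1$ and $\sum_{i=0}^k a_i^{(n,k)}\langle\mathbf y,\Delta\mathbf S_{n+j+i}\rangle=0$ for $j=0,\ldots,k-1$. Then $\boldsymbol{\widehat\varepsilon}_{2k}^{(n)}=a_0^{(n,k)}\mathbf S_n+\cdots+a_k^{(n,k)}\mathbf S_{n+k}$. Scalar $\varepsilon$-algorithm applied to a sequence of numbers $(S_n)$: $\varepsilon_{-1}^{(n)}=0$, $\varepsilon_0^{(n)}=S_n$, $\varepsilon_{k+1}^{(n)}=\varepsilon_{k-1}^{(n+1)}+(\varepsilon_k^{(n+1)}-\varepsilon_k^{(n)})^{-1}$ for $k,n=0,1,\ldots$. All quantities involved are assumed to be defined (the linear systems are uniquely solvable and the denominators are nonzero). *)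

(* Defs.v *)
From mathcomp Require Import all_boot all_order all_algebra.
From mathcomp Require Import all_classical all_reals all_analysis.
Set Implicit Arguments.
Unset Strict Implicit.
Unset Printing Implicit Defensive.

Import Order.TTheory GRing.Theory Num.Theory.
Import numFieldNormedType.Exports.

Local Open Scope classical_set_scope.
Local Open Scope ring_scope.

(* [numFieldType] covers both scalar fields of interest: R and R[i] for
   [R : realType]. A functional [y] takes its values in [K^o], the field [K]
   seen as a normed module over itself. *)

Definition is_shanks_coef (K : numFieldType) (E : normedModType K)
    (y : E -> K) (S : nat -> E) (k n : nat) (a : 'rV[K]_k.+1) : Prop :=
  \sum_(i < k.+1) a ord0 i = 1 /\
  forall j : nat, (j < k)%N ->
    \sum_(i < k.+1) a ord0 i * y (S (n + j + i).+1%N - S (n + j + i)%N) = 0.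

(* The default value [0] only matters when the system has no solution. *)
Definition shanks_coef (K : numFieldType) (E : normedModType K)
    (y : E -> K) (S : nat -> E) (k n : nat) : 'rV[K]_k.+1 :=
  xget 0 [set a | is_shanks_coef y S n a].

(* [topo_shanks y S k n] is the transform with lower index 2k and upper
   index n. *)
Definition topo_shanks (K : numFieldType) (E : normedModType K)
    (y : E -> K) (S : nat -> E) (k n : nat) : E :=
  \sum_(i < k.+1) shanks_coef y S k n ord0 i *: S (n + i)%N.

(* The lower index is shifted by one, so that the recursion can start from the
   column of index -1: [eps_shift s m n] has lower index m - 1. *)
Fixpoint eps_shift (K : numFieldType) (s : nat -> K) (m n : nat) : K :=
  match m with
  | 0 => 0
  | m'.+1 =>
    match m' with
    | 0 => s n
    | m''.+1 =>
        eps_shift s m'' n.+1 + (eps_shift s m' n.+1 - eps_shift s m' n)^-1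
    end
  end.

Definition eps (K : numFieldType) (s : nat -> K) (m n : nat) : K :=
  eps_shift s m.+1 n.

Definition shanks_ratio (K : numFieldType) (s : nat -> K) (k n : nat) : K :=
  (eps s k.+1.*2 n - eps s k.*2 n.+1) / (eps s k.*2 n.+1 - eps s k.*2 n).

(* Main.v *)
(** Identify a coefficient vector with the polynomial having these coefficients.
    The vectors defining the transforms 2k at n, 2k at n+1 and 2k+2 at n are
    then polynomials [a], [b], [c] with value 1 at 1, and
      [c = X b + r (X b - a)]
    where [r] is the ratio of the statement, computed by the scalar algorithm.
    Taking [c] to be the right-hand side, its first [k] orthogonality relations
    are inherited from [a] and [b]; the last one is where the epsilon-algorithm
    enters, through an invariant relating the odd columns to the leading
    coefficients. Hence, writing T_k(n) for the vector transforms,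
      T_(k+1)(n) = T_k(n+1) + r_n (T_k(n+1) - T_k(n)),
    where the differences tend to 0 and [r_n] is bounded. *)

Require Import Defs.
From mathcomp Require Import all_boot all_order all_algebra.
From mathcomp Require Import all_classical all_reals all_analysis.
From mathcomp Require Import ring.
Import Order.TTheory GRing.Theory Num.Theory.
Import numFieldNormedType.Exports.
Local Open Scope classical_set_scope.
Local Open Scope ring_scope.

(** * Moments of a sequence as linear maps on polynomials *)

(** The linear map sending ['X^i] to [u i]. Its target is a module, so that the same rules serve the
    scalars [y (S i)] and the vectors [S i]. *)
Definition moment {K : numFieldType} {V : lmodType K} (u : nat -> V)
    (p : {poly K}) : V := \sum_(i < size p) p`_i *: u i.

Lemma moment_widen {K : numFieldType} {V : lmodType K} (u : nat -> V) m
    (p : {poly K}) : (size p <= m)%N ->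
  moment u p = \sum_(i < m) p`_i *: u i.
Proof.
move=> le_pm; rewrite /moment (big_ord_widen m (fun i => p`_i *: u i)) //.
rewrite big_mkcond /=; apply: eq_bigr => i _.
by case: ltnP => // le_pi; rewrite nth_default // scale0r.
Qed.

Lemma momentD {K : numFieldType} {V : lmodType K} (u : nat -> V)
    (p q : {poly K}) : moment u (p + q) = moment u p + moment u q.
Proof.
pose m := maxn (size p) (size q).
rewrite (moment_widen u m (p + q)) ?size_polyD //.
rewrite (moment_widen u m p) ?leq_maxl // (moment_widen u m q) ?leq_maxr //.
by rewrite -big_split; apply: eq_bigr => i _; rewrite coefD scalerDl.
Qed.

Lemma momentZ {K : numFieldType} {V : lmodType K} (u : nat -> V) (c : K)
    (p : {poly K}) : moment u (c *: p) = c *: moment u p.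
Proof.
rewrite (moment_widen u (size p)) ?size_scale_leq // scaler_sumr.
by apply: eq_bigr => i _; rewrite coefZ scalerA.
Qed.

Lemma momentB {K : numFieldType} {V : lmodType K} (u : nat -> V)
    (p q : {poly K}) : moment u (p - q) = moment u p - moment u q.
Proof. by rewrite -(scaleN1r q) momentD momentZ scaleN1r. Qed.

Lemma momentXM {K : numFieldType} {V : lmodType K} (u : nat -> V)
    (p : {poly K}) : moment u ('X * p) = moment (fun i => u i.+1) p.
Proof.
rewrite (moment_widen u (size p).+1); last first.
  by rewrite (leq_trans (size_polyMleq _ _)) // size_polyX.
rewrite big_ord_recl coefXM /= scale0r add0r /moment.
by apply: eq_bigr => i _; rewrite coefXM.
Qed.

Lemma moment_prod {K : numFieldType} {V : lmodType K} (u : nat -> V)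
    (p q : {poly K}) :
  moment u (p * q) = \sum_(i < size p) p`_i *: moment u ('X^i * q).
Proof.
have mom0 : moment u 0 = 0 by rewrite /moment size_poly0 big_ord0.
rewrite -[X in moment u (X * q)]coefK poly_def mulr_suml.
rewrite (big_morph _ (momentD u) mom0).
by apply: eq_bigr => i _; rewrite -scalerAl momentZ.
Qed.

Definition value {K : numFieldType} (s : nat -> K) n (p : {poly K}) : K :=
  moment (fun i => s (n + i)%N : K^o) p.

Definition dvalue {K : numFieldType} (s : nat -> K) n (p : {poly K}) : K :=
  moment (fun i => s (n + i).+1 - s (n + i)%N : K^o) p.

Lemma valueXM {K : numFieldType} (s : nat -> K) n p :
  value s n ('X * p) = value s n.+1 p.
Proof. by rewrite /value momentXM; under eq_fun do rewrite addnS -addSn. Qed.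

Lemma dvalueXM {K : numFieldType} (s : nat -> K) n p :
  dvalue s n ('X * p) = dvalue s n.+1 p.
Proof. by rewrite /dvalue momentXM; under eq_fun do rewrite addnS -addSn. Qed.

Lemma dvalueXnM {K : numFieldType} (s : nat -> K) n j p :
  dvalue s n ('X^j * p) = dvalue s (n + j) p.
Proof.
elim: j n => [|j IH] n; first by rewrite mul1r addn0.
by rewrite exprS -mulrA dvalueXM IH addSnnS.
Qed.

Lemma valueB {K : numFieldType} (s : nat -> K) n p q :
  value s n (p - q) = value s n p - value s n q.
Proof. exact: momentB. Qed.

Lemma dvalueB {K : numFieldType} (s : nat -> K) n p q :
  dvalue s n (p - q) = dvalue s n p - dvalue s n q.
Proof. exact: momentB. Qed.

(** Multiplication by ['X] shifts the sequence, so ['X - 1] acts as the forward difference. *)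
Lemma value_XsubC1 {K : numFieldType} (s : nat -> K) n p :
  value s n (('X - 1) * p) = dvalue s n p.
Proof.
rewrite mulrBl mul1r valueB valueXM /value /dvalue /moment -sumrB.
by apply: eq_bigr => i _; rewrite -scalerBr.
Qed.

(** * Orthogonality and differences of neighbouring scalar transforms *)

Definition shanks_poly {K : numFieldType} (s : nat -> K) k n (p : {poly K}) :=
  [/\ (size p <= k.+1)%N, p.[1] = 1 &
      forall j, (j < k)%N -> dvalue s (n + j) p = 0].

(** Expanding [g] in powers of ['X], orthogonality kills every term of degree below [k]. *)
Lemma dvalue_shanks_mul {K : numFieldType} (s : nat -> K) k n (a g : {poly K}) :
  (forall j, (j < k)%N -> dvalue s (n + j) a = 0) -> (size g <= k.+1)%N ->
  dvalue s n (g * a) = g`_k * dvalue s (n + k) a.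
Proof.
move=> a_orth le_gk.
transitivity (\sum_(i < size g) g`_i * dvalue s (n + i) a).
  rewrite /dvalue moment_prod; apply: eq_bigr => i _.
  by rewrite -[moment _ ('X^i * a)]/(dvalue s n ('X^i * a)) dvalueXnM.
rewrite (big_ord_widen k.+1 (fun i => g`_i * dvalue s (n + i) a)) //.
rewrite big_mkcond big_ord_recr /= big1 ?add0r => [|i _].
  by case: ltnP => // le; rewrite nth_default // mul0r.
by rewrite a_orth // mulr0 if_same.
Qed.

(* [X b - a] vanishes at 1, so it equals [(X - 1) g], and the moments
   [D = dvalue s n (X^j g)] do not depend on [j <= k]. Computing the moment of
   [a g] by expanding [a], then by expanding [g], gives the identity. *)
Lemma value_shanks_diff {K : numFieldType} (s : nat -> K) k n (a b : {poly K}) :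
  shanks_poly s k n a -> shanks_poly s k n.+1 b ->
  value s n.+1 b - value s n a = b`_k * dvalue s (n + k) a.
Proof.
move=> [size_a a1 a_orth] [size_b b1 b_orth].
have /factor_theorem [g Dg] : root ('X * b - a) 1.
  by rewrite /root !hornerE a1 b1 subrr.
rewrite polyC1 (mulrC g) in Dg.
have size_g : (size g <= k.+1)%N.
  have [->|g0] := eqVneq g 0; first by rewrite size_poly0.
  have size_Mg : size (('X - 1) * g) = (size g).+1.
    by rewrite -polyC1 size_monicM ?monicXsubC // size_XsubC.
  rewrite -ltnS -size_Mg -Dg (leq_trans (size_polyD _ _)) // size_polyN.
  rewrite geq_max (leq_trans size_a) // andbT.
  by rewrite (leq_trans (size_polyMleq _ _)) // size_polyX.
have g_lead : g`_k = b`_k.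
  have /(congr1 (fun p : {poly K} => p`_k.+1)) := Dg.
  rewrite mulrBl mul1r !coefB !coefXM /=.
  by rewrite [a`__]nth_default // [g`_k.+1]nth_default // !subr0.
(* Consecutive moments differ by that of ['X^j * ('X * b - a)], which vanishes for [j < k] by the
   orthogonality of [a] and [b]. *)
have g_const j : (j <= k)%N -> dvalue s n ('X^j * g) = dvalue s n g.
  elim: j => [|j IH] lt_jk; first by rewrite mul1r.
  rewrite -IH 1?ltnW //; apply/eqP; rewrite -subr_eq0 -dvalueB.
  have -> : 'X^(j.+1) * g - 'X^j * g = 'X^j * ('X * b - a).
    by rewrite Dg exprS; ring.
  by rewrite dvalueXnM dvalueB dvalueXM -addSn a_orth ?b_orth ?subrr.
rewrite -valueXM -valueB Dg value_XsubC1 -g_lead.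
rewrite -(dvalue_shanks_mul s k n a g a_orth size_g) mulrC.
rewrite [in RHS]/dvalue moment_prod.
(* The constant moment factors out, and the coefficients of [a] sum to [a.[1] = 1]. *)
transitivity (\sum_(i < size a) a`_i * dvalue s n g).
  rewrite -mulr_suml -[LHS]mul1r -a1 horner_coef; congr (_ * _).
  by apply: eq_bigr => i _; rewrite expr1n mulr1.
apply: eq_bigr => i _.
by rewrite -[dvalue s n g](g_const i) // -ltnS (leq_trans (ltn_ord i)).
Qed.

(** * Polynomials generated by the scalar epsilon-algorithm *)

Fixpoint wynn_poly {K : numFieldType} (s : nat -> K) k n : {poly K} :=
  if k is k'.+1 then
    'X * wynn_poly s k' n.+1 +
    shanks_ratio s k' n *: ('X * wynn_poly s k' n.+1 - wynn_poly s k' n)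
  else 1.

(* [eps_shift s k.*2 n] is the entry of lower index 2k-1, which is 0 for
   [k = 0]; [eps] cannot express it. *)
Definition wynn_invariant {K : numFieldType} (s : nat -> K) k n :=
  (eps s k.*2.+1 n - eps_shift s k.*2 n) *
  ((wynn_poly s k n)`_k * dvalue s (n + k) (wynn_poly s k n)) = 1.

(** The last two conclusions tie the leading coefficient of [c] to the even columns; they serve to
    rebuild the invariant at [k.+1]. *)
Lemma wynn_poly_step {K : numFieldType} (s : nat -> K) k n
    (a := wynn_poly s k n) (b := wynn_poly s k n.+1) (c := wynn_poly s k.+1 n) :
  shanks_poly s k n a -> shanks_poly s k n.+1 b ->
  value s n a = eps s k.*2 n -> value s n.+1 b = eps s k.*2 n.+1 ->
  wynn_invariant s k n.+1 ->
  eps s k.*2 n.+1 - eps s k.*2 n != 0 ->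
  eps s k.*2.+1 n.+1 - eps s k.*2.+1 n != 0 ->
  [/\ shanks_poly s k.+1 n c, value s n c = eps s k.+1.*2 n,
      c`_k.+1 * dvalue s (n + k) a = eps s k.+1.*2 n - eps s k.*2 n &
      c`_k.+1 * dvalue s (n.+1 + k) b = eps s k.+1.*2 n - eps s k.*2 n.+1].
Proof.
move=> sa sb va vb.
rewrite /wynn_invariant -/b => inv_b D0 U0.
have := value_shanks_diff s k n a b sa sb; rewrite va vb => DE.
have cE : c = 'X * b + shanks_ratio s k n *: ('X * b - a) by [].
have e1 : eps s k.*2.+1 n =
    eps_shift s k.*2 n.+1 + (eps s k.*2 n.+1 - eps s k.*2 n)^-1 by [].
have e2 : eps s k.+1.*2 n =
  eps s k.*2 n.+1 + (eps s k.*2.+1 n.+1 - eps s k.*2.+1 n)^-1 by [].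
move: inv_b cE; rewrite /shanks_ratio; move: e1 e2 DE D0 U0 vb va.
have [size_a a1 a_orth] := sa; have [size_b b1 b_orth] := sb.
set A := dvalue s (n + k) a; set A' := dvalue s (n.+1 + k) b.
set t := eps s k.*2 n; set t' := eps s k.*2 n.+1; set t1 := eps s k.+1.*2 n.
set u := eps s k.*2.+1 n; set u' := eps s k.*2.+1 n.+1.
set v' := eps_shift s k.*2 n.+1; set rho := _ / _.
move=> uE t1E DE D0 U0 vb va inv_b cE.
have bk0 : b`_k != 0 by apply: contraNneq D0 => b0; rewrite DE b0 mul0r.
have UE : u' - u = u' - v' - (t' - t)^-1 by rewrite uE; ring.
have rhoD : rho * (t' - t) = t1 - t' by rewrite divfK.
have ak0 : a`_k.+1 = 0 by rewrite nth_default.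
have ck : c`_k.+1 = (1 + rho) * b`_k.
  by rewrite cE coefD coefZ coefB !coefXM /= ak0; ring.
have lead_a : c`_k.+1 * A = t1 - t.
  by rewrite ck -mulrA -DE mulrDl rhoD; ring.
have lead_b : c`_k.+1 * A' = t1 - t'.
  apply: (mulfI D0); rewrite ck.
  have -> : (t' - t) * ((1 + rho) * b`_k * A') =
            (t' - t + rho * (t' - t)) * (b`_k * A') by ring.
  have w_eq : (t1 - t') * (u' - u) = 1 by rewrite t1E addrAC subrr add0r mulVf.
  have vE : u' - v' = u' - u + (t' - t)^-1 by rewrite UE subrK.
  have -> : t' - t + rho * (t' - t) = (t' - t) * (t1 - t') * (u' - v').
    by rewrite rhoD vE mulrDr -mulrA w_eq mulr1 mulrAC divff // mul1r.
  by rewrite -mulrA inv_b mulr1.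
(* This is the orthogonality of [c] for [j = k], the one relation not inherited from [a] and [b]. *)
have A'E : (1 + rho) * A' = rho * A.
  apply: (mulfI bk0); rewrite mulrCA mulrA -ck lead_b mulrCA -DE.
  by rewrite rhoD.
have value_c : value s n c = t1.
  by rewrite cE /value momentD momentZ -!/(value _ _ _) valueB valueXM va vb
    -[_ *: _]/(rho * (t' - t)) rhoD addrC subrK.
split => //; split.
- rewrite cE (leq_trans (size_polyD _ _)) // geq_max.
  have size_Xb : (size ('X * b)%R <= k.+2)%N.
    by rewrite (leq_trans (size_polyMleq _ _)) // size_polyX.
  rewrite size_Xb (leq_trans (size_scale_leq _ _)) //.
  by rewrite (leq_trans (size_polyD _ _)) // size_polyN geq_max size_Xb ltnW.
- by rewrite cE !hornerE a1 b1; ring.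
- move=> j; rewrite ltnS => le_jk.
  have -> : dvalue s (n + j) c = (1 + rho) * dvalue s (n.+1 + j) b -
                                 rho * dvalue s (n + j) a.
    rewrite cE /dvalue momentD momentZ -!/(dvalue _ _ _) dvalueB dvalueXM.
    by rewrite -[_ *: _]/(rho * _) addSn; ring.
  have [->|ne_jk] := eqVneq j k; first by rewrite A'E subrr.
  have lt_jk : (j < k)%N by rewrite ltn_neqAle ne_jk.
  by rewrite a_orth // b_orth // !mulr0 subrr.
Qed.

Lemma wynn_poly_correct {K : numFieldType} (s : nat -> K) k :
  (forall m n, (m <= k.*2)%N -> eps s m n.+1 - eps s m n != 0) ->
  forall n, [/\ shanks_poly s k n (wynn_poly s k n),
    value s n (wynn_poly s k n) = eps s k.*2 n & wynn_invariant s k n].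
Proof.
elim: k => [|k IH] e_neq0 n.
  have mom1 (u : nat -> K^o) : moment u 1 = u 0%N.
    by rewrite /moment size_poly1 big_ord1 coef1 scale1r.
  split.
  - by split=> //; rewrite ?size_poly1 ?hornerE.
  - by rewrite /value mom1 addn0.
  - rewrite /wynn_invariant /dvalue mom1 coef1 /= !addn0 mul1r subr0.
    by rewrite /eps /= add0r mulVf // (e_neq0 0%N).
have IHk m : [/\ shanks_poly s k m (wynn_poly s k m),
    value s m (wynn_poly s k m) = eps s k.*2 m & wynn_invariant s k m].
  by apply: IH => i j le_ik; apply: e_neq0; rewrite doubleS !leqW.
have step m := let: And3 sa va _ := IHk m in let: And3 sb vb ib := IHk m.+1 in
  wynn_poly_step s k m sa sb va vb ib
    (e_neq0 k.*2 m (leqW (leqnSn _))) (e_neq0 k.*2.+1 m (leqnSn _)).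
have [sc vc lead_a lead_b] := step n.
have [sc' vc' lead_a' _] := step n.+1.
split=> //; rewrite /wynn_invariant.
have := value_shanks_diff s k.+1 n _ _ sc sc'; rewrite vc vc'.
have D0 := e_neq0 k.+1.*2 n (leqnn _).
have U0 := e_neq0 k.*2.+1 n (leqnSn _).
have e1 : eps s k.+1.*2.+1 n =
    eps s k.*2.+1 n.+1 + (eps s k.+1.*2 n.+1 - eps s k.+1.*2 n)^-1 by [].
have e2 : eps s k.+1.*2 n =
  eps s k.*2 n.+1 + (eps s k.*2.+1 n.+1 - eps s k.*2.+1 n)^-1 by [].
rewrite -[eps_shift s k.+1.*2 n]/(eps s k.*2.+1 n) e1.
move: lead_b lead_a' D0 U0 e2.
rewrite addSn -addnS.
set p := (_)`_k.+1; set p' := (wynn_poly s k.+1 n.+1)`_k.+1.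
set A' := dvalue _ _ (wynn_poly s k n.+1); set A1 := dvalue _ _ _.
set t1 := eps s k.+1.*2 n; set t' := eps s k.*2 n.+1.
set t1' := eps s k.+1.*2 n.+1.
set u := eps s k.*2.+1 n; set u' := eps s k.*2.+1 n.+1.
move=> lead_b lead_a' D0 U0 t1E DE.
have w_eq : (t1 - t') * (u' - u) = 1 by rewrite t1E addrAC subrr add0r mulVf.
have w0 : t1 - t' != 0.
  by apply: contraNneq (oner_neq0 K) => w0; rewrite -w_eq w0 mul0r.
have p0 : p' != 0 by apply: contraNneq D0 => p0; rewrite DE p0 mul0r.
(* The steps at [n] and [n.+1] share the moment [A'], whence [p * (t1' - t') = p' * (t1 - t')];
   these two factors reduce the goal to that equality. *)
apply: (mulfI w0); apply: (mulfI p0); rewrite mulr1.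
have -> : p' * ((t1 - t') * ((u' + (t1' - t1)^-1 - u) * (p * A1))) =
  ((t1 - t') * (u' - u) + (t1 - t') / (t1' - t1)) * p * (p' * A1) by ring.
rewrite w_eq -DE mulrAC mulrDl mul1r divfK // addrA subrK.
by rewrite -lead_a' -lead_b; ring.
Qed.

(** * Return to the vector transforms and passage to the limit *)

(** The coefficients of [p] solve the defining system, so uniqueness identifies them with the vector
    chosen by [xget]. *)
Lemma topo_shanksE {K : numFieldType} {E : normedModType K} (S : nat -> E)
    (y : {linear E -> K^o}) k n (p : {poly K}) :
  (exists! a : 'rV[K]_k.+1, is_shanks_coef y S n a) ->
  shanks_poly (fun i => y (S i)) k n p ->
  topo_shanks y S k n = moment (fun i => S (n + i)%N) p.
Proof.
move=> [a [sol_a uniq_a]] [size_p p1 p_orth].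
have sol_p : is_shanks_coef y S n (\row_(i < k.+1) p`_i).
  split=> [|j lt_jk].
    rewrite -p1 (horner_coef_wide _ size_p).
    by apply: eq_bigr => i _; rewrite mxE expr1n mulr1.
  rewrite -[RHS](p_orth j lt_jk) /dvalue (moment_widen _ _ _ size_p).
  by apply: eq_bigr => i _; rewrite mxE linearB.
have coefE : shanks_coef y S k n = \row_(i < k.+1) p`_i.
  by rewrite /shanks_coef; case: xgetP => [b _ /uniq_a <-|/(_ _ sol_p)//];
    apply: uniq_a.
rewrite /topo_shanks coefE (moment_widen _ _ _ size_p).
by apply: eq_bigr => i _; rewrite mxE.
Qed.

Lemma cvg0_scale_bounded {K : numFieldType} {E : normedModType K}
    (r : nat -> K) (u : nat -> E) (M : K) (N : nat) :
  (forall n, (N <= n)%N -> `|r n| <= M) -> u @ \oo --> (0 : E) ->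
  (fun n => r n *: u n) @ \oo --> (0 : E).
Proof.
move=> r_le u0; have M0 : 0 <= M := le_trans (normr_ge0 _) (r_le N (leqnn N)).
(* [M] may be 0, and the bound is used as a divisor. *)
have M1 : 0 < M + 1 by rewrite ltr_wpDl.
apply/cvgrPdist_lt => e e0; near=> n.
rewrite sub0r normrN normrZ (@le_lt_trans _ _ ((M + 1) * `|u n|)) //.
  rewrite ler_wpM2r // (le_trans (r_le n _)) ?lerDl //.
  by near: n; exists N.
rewrite mulrC -ltr_pdivlMr // -normrN -sub0r.
near: n; move/cvgrPdist_lt: u0; apply; exact: divr_gt0.
Unshelve. all: by end_near.
Qed.

Theorem theorem5 (K : numFieldType) (E : normedModType K) (S : nat -> E)
    (y : {linear E -> K^o}) (k : nat) (L : E)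
    (y_cont : continuous y)
    (solvable_k : forall n : nat,
       exists! a : 'rV[K]_k.+1, is_shanks_coef y S n a)
    (solvable_k1 : forall n : nat,
       exists! a : 'rV[K]_k.+2, is_shanks_coef y S n a)
    (eps_defined : forall m n : nat, (m < k.+1.*2)%N ->
       eps (fun i => y (S i)) m n.+1 - eps (fun i => y (S i)) m n != 0)
    (lim_k : topo_shanks y S k @ \oo --> L)
    (ratio_bounded : exists (M : K) (N : nat), forall n : nat, (N <= n)%N ->
       `|shanks_ratio (fun i => y (S i)) k n| <= M) :
  topo_shanks y S k.+1 @ \oo --> L.
Proof.
set s := fun i => y (S i) in eps_defined ratio_bounded.
have [M [N r_le]] := ratio_bounded.
have wynn n : [/\ shanks_poly s k n (wynn_poly s k n),
    value s n (wynn_poly s k n) = eps s k.*2 n & wynn_invariant s k n].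
  by apply: wynn_poly_correct => i j le_ik; apply: eps_defined;
    rewrite doubleS ltnS leqW.
pose T := topo_shanks y S k.
have T_k1 n : topo_shanks y S k.+1 n =
    T n.+1 + shanks_ratio s k n *: (T n.+1 - T n).
  have [sa va _] := wynn n; have [sb vb ib] := wynn n.+1.
  (* One bare step instead of [wynn_poly_correct] at [k.+1]: the invariant there would require
     nonzero differences in column [2k + 2], while [eps_defined] stops at [2k + 1]. *)
  have [sc _ _ _] := wynn_poly_step s k n sa sb va vb ib
    (eps_defined k.*2 n (leqnSn _)) (eps_defined k.*2.+1 n (leqnn _)).
  rewrite (topo_shanksE S y k.+1 n _ (solvable_k1 n) sc).
  rewrite /T (topo_shanksE S y k n _ (solvable_k n) sa).
  rewrite (topo_shanksE S y k n.+1 _ (solvable_k n.+1) sb).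
  rewrite /= momentD momentZ momentB momentXM.
  by under eq_fun do rewrite addnS -addSn.
rewrite (eq_cvg _ _ T_k1).
have T_succ : (fun n => T n.+1) @ \oo --> L by rewrite cvg_shiftS.
rewrite -[L]addr0; apply: cvgD => //.
apply: cvg0_scale_bounded r_le _; rewrite -(subrr L).
exact: cvgB.
Qed.
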